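(* Let $n,k\in\mathbb{N}$ with $n$ even and $k\geq 3$, such that at least one of $k$ and $n/2$ is even. Let $T=\{x\in\{0,1\}^n:|x|=n/2\}$ and let $f:T\to\{0,1\}$ be a function which passes the $k$-query BLR test on $T$ with probability $\frac{1+\delta}{2}$, where $\delta>0$. Then there exist $u\in\{0,1\}^n$ and $b\in\{0,1\}$ such that \[ \Pr_{x\sim T}\bigl[f(x)=u\cdot x+b\bigr]\;\geq\;\frac{1+\delta^{\frac{1}{k-2}}}{2}-o(1). \]
   Context: $|x|$ denotes Hamming weight; all arithmetic is modulo $2$ and $u\cdot x=\sum_i u_ix_i$. The $k$-query BLR test on $T$ samples $x_1,\dots,x_{k-1}$ uniformly from $\{0,1\}^n$ conditioned on $x_1,\dots,x_{k-1},x_1+\cdots+x_{k-1}\in T$, and accepts iff $f(x_1+\cdots+x_{k-1})=f(x_1)+\cdots+f(x_{k-1})$. $x\sim T$ means $x$ uniform in $T$. The term $o(1)$ denotes a quantity depending only on $n$ and $k$ (not on $f$) that tends to $0$ as $n\to\infty$ with $k$ fixed. *)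

(* Defs.v *)
From mathcomp Require Import all_boot all_order all_algebra.
From mathcomp Require Import reals.

Set Implicit Arguments.
Unset Strict Implicit.
Unset Printing Implicit Defensive.

Import GRing.Theory.
Local Open Scope ring_scope.

(* The cube {0,1}^n with arithmetic modulo 2 is 'rV['F_2]_n. *)

Definition hamming_weight (n : nat) (x : 'rV['F_2]_n) : nat :=
  #|[set i | x 0 i != 0]|.

Definition dotp (n : nat) (u x : 'rV['F_2]_n) : 'F_2 :=
  \sum_(i < n) u 0 i * x 0 i.

(* n./2 rounds down; this is only the middle slice for even n. *)
Definition middle_slice (n : nat) : {set 'rV['F_2]_n} :=
  [set x | hamming_weight x == n./2].

(* Probability of P under the uniform distribution on A, for nonempty A. *)
Definition unif_prob (R : realType) (U : finType) (A : {set U}) (P : pred U)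
    : R :=
  #|[set x in A | P x]|%:R / #|A|%:R.

(* The support of the query distribution of the k-query test: the uniform
   distribution on k.-1 points of the cube, conditioned on an event, is the
   uniform distribution on that event. *)
Definition blr_samples (n k : nat) (T : {set 'rV['F_2]_n})
    : {set {ffun 'I_k.-1 -> 'rV['F_2]_n}} :=
  [set x : {ffun 'I_k.-1 -> 'rV['F_2]_n} |
    [forall i, x i \in T] && (\sum_i x i \in T)].

Definition blr_accepts (n k : nat) (f : 'rV['F_2]_n -> 'F_2)
    (x : {ffun 'I_k.-1 -> 'rV['F_2]_n}) : bool :=
  f (\sum_i x i) == \sum_i f (x i).

(* f stands for a function T -> {0,1}: only its values on T are used. *)
Definition blr_pass_prob (R : realType) (n k : nat) (T : {set 'rV['F_2]_n})
    (f : 'rV['F_2]_n -> 'F_2) : R :=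
  unif_prob R (blr_samples k T) (@blr_accepts n k f).

(* Main.v *)
Require Import Defs.
From mathcomp Require Import classical_sets reals topology normedtype exp.
From mathcomp Require Import all_boot all_order all_algebra perm.
From mathcomp Require Import zify ring lra.

(** Let [g u] be the correlation of [(-1)^f] with the character [u] over the
    middle slice [T], and [nu u] the same quantity for the constant function.
    Fourier inversion gives [sum g^k = delta * sum nu^k]. Since the signs
    [(-1)^(x_i)] add up to [0] on [T], [nu] is [1] at [0], [+-1] at the all-ones
    vector, [O(1/n)] at weights [2] and [n - 2], and [O(1/n^2)] elsewhere; hence
    [sum nu^k = 2 - o(1)].

    By duality, [(sum b g)^2 <= sum b_u b_v nu (u + v)] for every [b]. Put
    [eps = n^(-1/3)].
    - With [b = g] on [{|g| >= eps}], this gives [sum g^2 <= 2 + o(1)] there.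
    - With [b = g |g|] on [{|g| < eps}], it bounds the sum of [|g|^3] there,
      although Parseval only yields [sum g^2 = 2^n / |T| = O(sqrt n)]. The
      dangerous terms are the pairs with [u + v] of weight [2] or [n - 2]; these
      form a graph in which two vertices that are neither equal nor complementary
      have only [O(n)] common neighbours, and Cauchy-Schwarz makes their
      contribution [o(1)].

    Therefore [2 delta - o(1) <= (max |g|)^(k-2) * (2 + o(1)) + o(1)]. *)

Set Implicit Arguments.
Unset Strict Implicit.

Import Order.TTheory GRing.Theory Num.Theory.
Import numFieldNormedType.Exports.
Local Open Scope ring_scope.

(** * Characters of the cube *)

Lemma F2_cases (a : 'F_2) : (a = 0) + (a = 1).
Proof. by case: a => [[|[|]]] //= i; [left|right]; apply: val_inj. Qed.

Lemma addrr_F2 (n : nat) (x : 'rV['F_2]_n) : x + x = 0.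
Proof.
apply/rowP=> i; rewrite !mxE.
by case: (F2_cases (x 0 i)) => ->; apply: val_inj.
Qed.

Lemma addrK_F2 (n : nat) (x y : 'rV['F_2]_n) : x + y + y = x.
Proof. by rewrite -addrA addrr_F2 addr0. Qed.

Lemma addKr_F2 (n : nat) (x y : 'rV['F_2]_n) : y + (y + x) = x.
Proof. by rewrite addrA addrr_F2 add0r. Qed.

Lemma addr_eq0_F2 (n : nat) (x y : 'rV['F_2]_n) : (x + y == 0) = (x == y).
Proof.
by apply/eqP/eqP=> [e|->]; [rewrite -(addrK_F2 x y) e add0r|exact: addrr_F2].
Qed.

Lemma norm_eq1 (R : realDomainType) (a : R) : a * a = 1 -> `|a| = 1.
Proof.
rewrite -expr2 => /eqP; rewrite sqrf_eq1.
by case/orP => /eqP ->; rewrite ?normrN normr1.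
Qed.

Section Characters.
Variables (R : realFieldType) (n : nat).
Local Notation V := 'rV['F_2]_n.
Implicit Types (a b : 'F_2) (u v w x y : V).

Definition F2sign (a : 'F_2) : R := (-1) ^+ a.

Lemma F2sign0 : F2sign 0 = 1. Proof. by []. Qed.

Lemma F2sign1 : F2sign 1 = -1. Proof. by []. Qed.

Lemma F2signD a b : F2sign (a + b) = F2sign a * F2sign b.
Proof.
case: (F2_cases a) => ->; case: (F2_cases b) => ->;
  rewrite ?add0r ?addr0 ?F2sign0 ?F2sign1 ?mul1r ?mulr1 //.
by rewrite mulrNN mulr1 -F2sign0; congr F2sign; apply: val_inj.
Qed.

Lemma F2sign_sqr a : F2sign a * F2sign a = 1.
Proof. by case: (F2_cases a) => ->; rewrite ?F2sign0 ?F2sign1 ?mulrNN mulr1. Qed.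

Lemma F2sign_sum (I : Type) (r : seq I) (P : pred I) (F : I -> 'F_2) :
  F2sign (\sum_(i <- r | P i) F i) = \prod_(i <- r | P i) F2sign (F i).
Proof. exact: (big_morph F2sign F2signD F2sign0). Qed.

Definition chi u x : R := F2sign (dotp u x).

Lemma chiC u x : chi u x = chi x u.
Proof.
by rewrite /chi /dotp; congr F2sign; apply: eq_bigr => i _; rewrite mulrC.
Qed.

Lemma chiDr u x y : chi u (x + y) = chi u x * chi u y.
Proof.
rewrite /chi -F2signD /dotp -big_split /=; congr F2sign.
by apply: eq_bigr => i _; rewrite mxE mulrDr.
Qed.

Lemma chiDl u v x : chi (u + v) x = chi u x * chi v x.
Proof. by rewrite chiC chiDr !(chiC x). Qed.

Lemma chi_sqr u x : chi u x * chi u x = 1.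
Proof. exact: F2sign_sqr. Qed.

Lemma chi0 u : chi u 0 = 1.
Proof.
by rewrite /chi /dotp big1 ?F2sign0 // => i _; rewrite mxE mulr0.
Qed.

Lemma chi_sum u (I : Type) (r : seq I) (P : pred I) (F : I -> V) :
  chi u (\sum_(i <- r | P i) F i) = \prod_(i <- r | P i) chi u (F i).
Proof. exact: (big_morph (chi u) (chiDr u) (chi0 u)). Qed.

Lemma dotp_delta (i : 'I_n) x : dotp (delta_mx 0 i) x = x 0 i.
Proof.
rewrite /dotp (bigD1 i) //= mxE !eqxx mul1r big1 ?addr0 // => j ji.
by rewrite mxE (negPf ji) andbF mul0r.
Qed.

Lemma sum_addr (S : nmodType) (F : V -> S) w : \sum_u F (u + w) = \sum_u F u.
Proof.
rewrite [RHS](reindex_inj (h := fun u => u + w)) //; exact: addIr.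
Qed.

(** If [x] has a coordinate [i] equal to 1, translating [u] by the unit vector at [i] flips the sign
    of every term, so the sum is its own negative. *)
Lemma sum_chi x : \sum_u chi u x = if x == 0 then 2 ^+ n else 0.
Proof.
case: eqP => [->|/eqP x0].
  rewrite (eq_bigr (fun=> 1)) => [|u _]; last exact: chi0.
  by rewrite sumr_const card_mx mul1n card_Fp // natrX.
have [i xi] : exists i, x 0 i != 0.
  by apply/existsP; apply: contraNT x0; rewrite negb_exists => /forallP h;
     apply/eqP/rowP => i; rewrite mxE; apply/eqP; have := h i; rewrite negbK.
have xi1 : x 0 i = 1 by case: (F2_cases (x 0 i)) xi => ->.
have : \sum_u chi u x = - \sum_u chi u x.
  rewrite -{1}(sum_addr _ (delta_mx 0 i)) -sumrN.
  by apply: eq_bigr => u _; rewrite chiDl {2}/chi dotp_delta xi1 F2sign1 mulrN1.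
by lra.
Qed.

(** Normalised by the size of [T], not by 2^n. The characters need not be orthogonal on [T], and the
    total energy in [parseval] is 2^n / |T| instead of 1. *)
Definition coef (T : {set V}) (F : V -> R) u : R :=
  (\sum_(x in T) F x * chi u x) / #|T|%:R.

Lemma parseval (T : {set V}) (F : V -> R) :
  (forall x, F x * F x = 1) -> (0 < #|T|)%N ->
  \sum_u coef T F u ^+ 2 = 2 ^+ n / #|T|%:R.
Proof.
move=> F1 T0; have T0' : #|T|%:R != 0 :> R by rewrite pnatr_eq0 -lt0n.
rewrite (eq_bigr (fun u => \sum_(x in T) \sum_(y in T)
   (F x * F y * chi u (x + y)) / #|T|%:R ^+ 2)) => [|u _]; last first.
  rewrite /coef expr_div_n expr2 big_distrlr /= mulr_suml.
  apply: eq_bigr => x _; rewrite mulr_suml; apply: eq_bigr => y _.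
  by rewrite chiDr; ring.
rewrite exchange_big /=.
rewrite (eq_bigr (fun x => 2 ^+ n / #|T|%:R ^+ 2)) => [|x xT].
  by rewrite sumr_const -mulr_natr; field.
rewrite exchange_big /= (bigD1 x) //= [X in _ + X]big1 => [|y /andP[_ yx]].
  by rewrite -mulr_suml -mulr_sumr sum_chi addr_eq0_F2 eqxx F1 mul1r addr0.
rewrite -mulr_suml -mulr_sumr sum_chi addr_eq0_F2 eq_sym (negPf yx).
by rewrite mulr0 mul0r.
Qed.

Lemma coef_le1 (T : {set V}) (F : V -> R) u :
  (forall x, F x * F x = 1) -> (0 < #|T|)%N -> `|coef T F u| <= 1.
Proof.
move=> F1 T0; rewrite /coef normrM normfV normr_nat.
rewrite ler_pdivrMr ?ltr0n // mul1r (le_trans (ler_norm_sum _ _ _)) //.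
rewrite -sumr_const; apply: ler_sum => x _.
by rewrite normrM (norm_eq1 (F1 x)) mul1r (norm_eq1 (chi_sqr u x)).
Qed.

(** Weighted Cauchy-Schwarz: the double sum of w_i w_j (t_i - t_j)^2 is nonnegative and equals twice
    the gap. *)
Lemma jensen_sqr (I : finType) (P : pred I) (w t : I -> R) :
  (forall i, 0 <= w i) ->
  (\sum_(i | P i) w i * t i) ^+ 2 <=
    (\sum_(i | P i) w i) * (\sum_(i | P i) w i * t i ^+ 2).
Proof.
move=> w0.
have : 0 <= \sum_(i | P i) \sum_(j | P j) (w i * w j) * (t i - t j) ^+ 2.
  by apply: sumr_ge0 => i _; apply: sumr_ge0 => j _;
     rewrite mulr_ge0 ?sqr_ge0 // mulr_ge0.
set a := \sum_(i | P i) w i; set b := \sum_(i | P i) w i * t i ^+ 2.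
set c := \sum_(i | P i) w i * t i.
rewrite (eq_bigr (fun i => w i * t i ^+ 2 * a + w i * b - w i * t i * (c *+ 2)));
  last first.
  move=> i _; rewrite /a /b /c -sumrMnl !mulr_sumr -big_split -sumrB /=.
  by apply: eq_bigr => j _; ring.
by rewrite sumrB big_split /= -!mulr_suml -/a -/b -/c expr2; lra.
Qed.

(** The left sum is the average over [T] of [F * h], where [h] is the combination of characters with
    weights [b]. Cauchy-Schwarz and F^2 = 1 bound its square by the average of h^2, and a product of
    two characters is the character at [u + v]. *)
Lemma coef_dual (T : {set V}) (F b : V -> R) :
  (forall x, F x * F x = 1) -> (0 < #|T|)%N ->
  (\sum_u b u * coef T F u) ^+ 2 <=
    \sum_u \sum_v b u * b v * coef T (fun=> 1) (u + v).
Proof.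
move=> F1 T0; have T0' : #|T|%:R != 0 :> R by rewrite pnatr_eq0 -lt0n.
pose h x := \sum_u b u * chi u x.
(* The factor 1 is the weight at which [jensen_sqr] is applied below. *)
have -> : \sum_u b u * coef T F u = (\sum_(x in T) 1 * (F x * h x)) / #|T|%:R.
  under eq_bigr => u _ do rewrite /coef mulrA mulr_sumr.
  rewrite -mulr_suml exchange_big /=; congr (_ / _); apply: eq_bigr => x _.
  by rewrite mul1r /h mulr_sumr; apply: eq_bigr => u _; ring.
have -> : \sum_u \sum_v b u * b v * coef T (fun=> 1) (u + v) =
    (\sum_(x in T) 1 * (F x * h x) ^+ 2) / #|T|%:R.
  have -> : \sum_(x in T) 1 * (F x * h x) ^+ 2 =
      \sum_(x in T) \sum_u \sum_v b u * b v * (1 * chi (u + v) x).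
    apply: eq_bigr => x _; rewrite mul1r exprMn expr2 F1 mul1r expr2.
    rewrite big_distrlr /=; apply: eq_bigr => u _; apply: eq_bigr => v _.
    by rewrite chiDl; ring.
  rewrite [in RHS]exchange_big mulr_suml /=; apply: eq_bigr => u _.
  rewrite [in RHS]exchange_big mulr_suml /=; apply: eq_bigr => v _.
  by rewrite /coef mulrA mulr_sumr.
rewrite expr_div_n ler_pdivrMr ?exprn_gt0 ?ltr0n //.
rewrite (le_trans (jensen_sqr _ _ _)) // ?sumr_const.
by rewrite [#|T|%:R ^+ 2]expr2 mulrA divfK // mulrC.
Qed.

(** The k-th power expands over k-tuples of points of [T]. Summing over [u] keeps only the tuples
    adding up to 0, that is, those whose first point is the sum of the other [k.-1]: these are the
    samples of the test. *)
Lemma coef_moment (T : {set V}) (F : V -> R) (k : nat) :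
  (0 < k)%N -> (0 < #|T|)%N ->
  \sum_u coef T F u ^+ k =
    2 ^+ n / #|T|%:R ^+ k *
    \sum_(x in blr_samples k T) F (\sum_i x i) * \prod_i F (x i).
Proof.
move=> k0 T0.
have pw u : (\sum_(x in T) F x * chi u x) ^+ k =
    \sum_(y in T) \sum_(x : {ffun 'I_k.-1 -> V} | [forall i, x i \in T])
      F y * (\prod_i F (x i)) * chi u (y + \sum_i x i).
  (* One factor is kept apart for the point [y] at which the sum is queried. *)
  have -> (a : R) : a ^+ k = a * \prod_(i < k.-1) a.
    by rewrite prodr_const card_ord -exprS prednK.
  rewrite (bigA_distr_big (mem T)) /= mulr_suml.
  apply: eq_bigr => y _; rewrite mulr_sumr; apply: eq_big => [x|x _].
    by apply/familyP/forallP => h i; have := h i.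
  by rewrite chiDr chi_sum big_split /=; ring.
under eq_bigr => u _ do rewrite /coef expr_div_n pw.
rewrite -mulr_suml exchange_big /= mulrAC; congr (_ / _).
under eq_bigr => y _ do rewrite exchange_big /=.
rewrite exchange_big /= mulr_sumr [LHS]big_mkcond [RHS]big_mkcond /=.
apply: eq_bigr => x _; rewrite inE.
case: [forall i, _] => //=.
under eq_bigr => y _ do rewrite -mulr_sumr sum_chi addr_eq0_F2.
case: ifPn => xT.
  rewrite (bigD1 (\sum_i x i)) //= eqxx [X in _ + X]big1 => [|y].
    by rewrite addr0 mulrC.
  by case/andP => _ yx; rewrite (negPf yx) mulr0.
rewrite big1 // => y yT; case: eqP => [e|_]; last by rewrite mulr0.
by rewrite -e yT in xT.
Qed.
End Characters.

(** * The Fourier transform of the middle slice *)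

Lemma F2_neq0 (a : 'F_2) : (a != 0) = (a == 1).
Proof. by case: (F2_cases a) => ->. Qed.

Lemma card_middle_slice (n : nat) : #|middle_slice n| = 'C(n, n./2).
Proof.
rewrite -[X in 'C(X, _)]card_ord -card_draws.
pose ind (A : {set 'I_n}) : 'rV['F_2]_n := \row_i (if i \in A then 1 else 0).
have supp A : [set i | ind A 0 i != 0] = A.
  by apply/setP => i; rewrite inE mxE; case: ifP.
have ind_inj : injective ind by move=> A B AB; rewrite -(supp A) AB supp.
rewrite -(card_imset _ ind_inj); apply: eq_card => x; rewrite inE.
apply/eqP/imsetP => [hx|[A]].
  exists [set i | x 0 i != 0]; first by rewrite inE; apply/eqP.
  apply/rowP => i; rewrite mxE inE; case: ifP; first by rewrite F2_neq0 => /eqP.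
  by move/negbFE/eqP.
by rewrite inE => /eqP hA ->; rewrite /hamming_weight supp.
Qed.

Lemma middle_slice_gt0 (n : nat) : (0 < #|middle_slice n|)%N.
Proof. by rewrite card_middle_slice bin_gt0; lia. Qed.

Section Slice.
Variables (R : realFieldType) (n : nat).
Local Notation V := 'rV['F_2]_n.
Local Notation e := (delta_mx 0).
Local Notation ones := (const_mx 1 : V).
Implicit Types (u v w x y z : V) (i l : 'I_n).

Lemma hamming_weight_delta i w :
  w 0 i != 0 -> hamming_weight (w + e i) = (hamming_weight w).-1.
Proof.
move=> wi; rewrite /hamming_weight (cardsD1 i [set l | w 0 l != 0]) inE wi /=.
apply: eq_card => l; rewrite !inE !mxE eqxx /=.
have [->|li] := eqVneq l i; last by rewrite addr0.
by move: wi; rewrite F2_neq0 => /eqP ->.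
Qed.

Lemma hamming_weight_ones w :
  hamming_weight (w + ones) = (n - hamming_weight w)%N.
Proof.
rewrite /hamming_weight -[X in (X - _)%N]card_ord -cardsT -cardsDS ?subsetT //.
apply: eq_card => l; rewrite !inE !mxE andbT.
by case: (F2_cases (w 0 l)) => ->.
Qed.

Lemma hamming_weight_le w : (hamming_weight w <= n)%N.
Proof. by rewrite -[X in (_ <= X)%N]card_ord max_card. Qed.

Lemma hamming_weight_eq0 w : (hamming_weight w == 0%N) = (w == 0).
Proof.
rewrite cards_eq0; apply/eqP/eqP => [/setP h|->].
  apply/rowP => l; rewrite mxE; apply/eqP.
  by have := h l; rewrite !inE => /negbFE.
by apply/setP => l; rewrite !inE mxE eqxx.
Qed.

Lemma hamming_weight_eqn w : (hamming_weight w == n) = (w == ones).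
Proof.
rewrite -addr_eq0_F2 -hamming_weight_eq0 hamming_weight_ones subn_eq0.
by rewrite eqn_leq hamming_weight_le.
Qed.

Lemma hamming_weight_eq1 w : hamming_weight w = 1%N -> exists l, w = e l.
Proof.
move/eqP/cards1P => [l /setP h]; exists l; apply/rowP => m.
rewrite mxE eqxx /=; have := h m; rewrite !inE; case: (m == l).
  by rewrite F2_neq0 => /eqP.
by move/negbFE/eqP.
Qed.

Lemma hamming_weight_perm (s : 'S_n) w :
  hamming_weight (col_perm s w) = hamming_weight w.
Proof.
rewrite /hamming_weight -[RHS](card_preimset _ (@perm_inj _ s)).
by apply: eq_card => l; rewrite !inE mxE.
Qed.

Lemma chi_delta l x : chi R (e l) x = F2sign R (x 0 l).
Proof. by rewrite /chi dotp_delta. Qed.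

Lemma F2sign_natr (a : 'F_2) : F2sign R a = 1 - 2 * (a != 0)%:R.
Proof. by case: (F2_cases a) => ->; rewrite ?F2sign0 ?F2sign1 /=; lra. Qed.

Lemma sum_chi_delta x :
  \sum_l chi R (e l) x = n%:R - 2 * (hamming_weight x)%:R.
Proof.
under eq_bigr => l _ do rewrite chi_delta F2sign_natr.
have -> : hamming_weight x = (\sum_l (x 0%R l != 0%R))%N.
  rewrite /hamming_weight -sum1dep_card big_mkcond.
  by apply: eq_bigr => l _; case: eqP.
by rewrite sumrB sumr_const card_ord -mulr_sumr -natr_sum.
Qed.

Lemma chi_ones x : chi R ones x = (-1) ^+ hamming_weight x.
Proof.
rewrite /chi /dotp F2sign_sum /hamming_weight -prodr_const.
rewrite [RHS]big_mkcond /=; apply: eq_bigr => l _; rewrite mxE mul1r inE.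
by case: (F2_cases (x 0 l)) => ->.
Qed.

Lemma chi_perm (s : 'S_n) u x : chi R (col_perm s u) (col_perm s x) = chi R u x.
Proof.
rewrite /chi /dotp [in RHS](reindex_inj (@perm_inj _ s)) /=.
by congr F2sign; apply: eq_bigr => l _; rewrite !mxE.
Qed.

Local Notation T := (middle_slice n).
Definition nu w : R := coef T (fun=> 1) w.

Lemma nu0 : nu 0 = 1.
Proof.
rewrite /nu /coef (eq_bigr (fun=> 1)) => [|x _]; last by rewrite chiC chi0 mulr1.
by rewrite sumr_const divff // pnatr_eq0 -lt0n middle_slice_gt0.
Qed.

Lemma chi_ones_slice x : x \in T -> chi R ones x = (-1) ^+ n./2.
Proof. by rewrite inE chi_ones => /eqP ->. Qed.

(** The all-ones character is constant on the slice, so coefficients at complementary vectors agree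
    up to a common sign. *)
Lemma coef_ones (F : V -> R) w :
  coef T F (w + ones) = (-1) ^+ n./2 * coef T F w.
Proof.
rewrite /coef mulrA mulr_sumr; congr (_ / _); apply: eq_bigr => x xT.
by rewrite chiDl (chi_ones_slice xT); ring.
Qed.

Lemma nu_ones : nu ones = (-1) ^+ n./2.
Proof. by rewrite -(add0r ones) /nu coef_ones -/(nu 0) nu0 mulr1. Qed.

Lemma normr_nu_ones w : `|nu (w + ones)| = `|nu w|.
Proof. by rewrite /nu coef_ones normrM normr_sign mul1r. Qed.

Lemma nu_perm (s : 'S_n) w : nu (col_perm s w) = nu w.
Proof.
rewrite /nu /coef; congr (_ / _).
have inj : injective (@col_perm 'F_2 1 n s).
  move=> x y /rowP h; apply/rowP => l.
  by have := h (s^-1%g l); rewrite !mxE permKV.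
rewrite (reindex_inj inj) /=; apply: eq_big => [x|x _].
  by rewrite !inE hamming_weight_perm.
by rewrite chi_perm.
Qed.

Hypothesis n_even : ~~ odd n.

(** At a point [x] of the slice the signs of the coordinates add up to n - 2|x| = 0. *)
Lemma sum_nu_delta w : \sum_l nu (w + e l) = 0.
Proof.
rewrite /nu /coef -mulr_suml exchange_big /= big1 ?mul0r // => x.
rewrite inE => /eqP xT.
under eq_bigr => l _ do rewrite chiDl mul1r.
rewrite -mulr_sumr sum_chi_delta xT -natrM mul2n.
by rewrite -[X in X%:R - _]odd_double_half (negPf n_even) subrr mulr0.
Qed.

(** Delete one coordinate [i] from the support of [w] and apply [sum_nu_delta] to the result [w'].
    The n + 1 - |w| coordinates outside the support of [w'] lead to vectors of weight |w|, where
    [nu] takes the same value by symmetry; the other |w| - 1 lead to weight |w| - 2. *)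
Lemma nu_recursion w (B : R) : (0 < hamming_weight w)%N ->
  (forall v, (hamming_weight v).+2 = hamming_weight w -> `|nu v| <= B) ->
  (n.+1 - hamming_weight w)%:R * `|nu w| <= (hamming_weight w).-1%:R * B.
Proof.
move=> w0 hB; have [i wi] : exists i, w 0 i != 0.
  by case/card_gt0P: w0 => i; rewrite inE; exists i.
set w' := w + e i.
have := sum_nu_delta w'; rewrite (bigID (fun l => w' 0 l != 0)) /=.
rewrite addrC (eq_bigr (fun=> nu w)) => [|l]; last first.
  (* The transposition of [i] and [l] carries [w] to [w' + e l]. *)
  rewrite negbK => /eqP w'l; rewrite -(nu_perm (tperm i l) w); congr nu.
  have [->|li] := eqVneq l i; first by rewrite tperm1 col_perm1 addrK_F2.
  have wi1 : w 0 i = 1 by apply/eqP; rewrite -F2_neq0.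
  apply/rowP => m; move: w'l; rewrite /w' !mxE !eqxx (negPf li) addr0 /= => wl.
  case: tpermP => [->|->|/eqP mi /eqP ml].
  - by rewrite eqxx eq_sym (negPf li) addr0 wi1 wl; apply: val_inj.
  - by rewrite eqxx (negPf li) wl !add0r wi1.
  - by rewrite (negPf mi) (negPf ml) !addr0.
rewrite sumr_const => /eqP; rewrite addr_eq0 => /eqP eq0.
have cC : #|[pred l | ~~ (w' 0 l != 0)]| = (n.+1 - hamming_weight w)%N.
  have := cardC [pred l | w' 0 l != 0]; rewrite card_ord => cn.
  have cw2 : #|[pred l | w' 0 l != 0]| = (hamming_weight w).-1.
    by rewrite -(hamming_weight_delta wi) /hamming_weight cardsE; apply: eq_card.
  rewrite cw2 in cn; have := hamming_weight_le w.
  have -> : #|[pred l | ~~ (w' 0 l != 0)]| = #|[predC [pred l | w' 0 l != 0]]|.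
    exact: eq_card.
  move: cn w0; move: #|_| (hamming_weight w) => c h; lia.
rewrite cC in eq0.
rewrite mulr_natl -normrMn eq0 normrN (le_trans (ler_norm_sum _ _ _)) //.
rewrite -(hamming_weight_delta wi) /hamming_weight mulr_natl -sumr_const.
rewrite big_mkcond [leRHS]big_mkcond /=; apply: ler_sum => l _; rewrite inE.
case: ifP => // w'l; apply: hB.
have : (0 < hamming_weight w')%N by apply/card_gt0P; exists l; rewrite inE.
by rewrite !hamming_weight_delta //; lia.
Qed.

Hypothesis n_ge6 : (6 <= n)%N.

Lemma nu_weight1 w : hamming_weight w = 1%N -> nu w = 0.
Proof.
move=> hw; have := @nu_recursion w 0; rewrite hw mul0r => /(_ isT).
have n0 : 0 < n%:R :> R by rewrite ltr0n; lia.
by rewrite subn1 /= pmulr_rle0 // normr_le0 => h; apply/eqP/h.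
Qed.

Lemma nu_weight2 w : hamming_weight w = 2 -> `|nu w| <= (n%:R - 1)^-1.
Proof.
move=> hw; have := @nu_recursion w 1; rewrite hw mul1r => /(_ isT).
have n0 : 0 < n%:R - 1 :> R by rewrite subr_gt0 ltr1n; lia.
move=> h; rewrite -(ler_pM2l n0) mulfV ?gt_eqF //.
have -> : n%:R - 1 = (n.+1 - 2)%:R :> R by rewrite subSS natrB //; lia.
apply: h => v [/eqP]; rewrite hamming_weight_eq0 => /eqP ->.
by rewrite nu0 normr1.
Qed.

Local Notation c4 := (3 / ((n%:R - 1) * (n%:R - 3)) : R).

(** [nu] vanishes at weights 1 and 3, and the recursion from weight 2 gives [c4] at weight 4. From
    weight 5 on the bound is inherited from weight |w| - 2, because 2|w| <= n + 2 says exactly that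
    |w| - 1 <= n + 1 - |w|. *)
Lemma nu_low_weight w :
  hamming_weight w != 0%N -> hamming_weight w != 2 ->
  ((hamming_weight w).*2 <= n.+2)%N -> `|nu w| <= c4.
Proof.
have n1 : 6 <= n%:R :> R by rewrite ler_nat.
have c0 : 0 <= c4 by apply: divr_ge0 => //; apply: mulr_ge0; lra.
have [m] := ubnP (hamming_weight w); elim: m w => // m IH w hm w0 w2 wn.
have [w1|w1] := eqVneq (hamming_weight w) 1%N.
  by rewrite nu_weight1 // normr0.
have [w3|w3] := eqVneq (hamming_weight w) 3.
  have := @nu_recursion w 0; rewrite w3 => /(_ isT) h.
  have : (n.+1 - 3)%:R * `|nu w| <= 3.-1%:R * 0.
    by apply: h => v [hv]; rewrite nu_weight1 ?normr0.
  rewrite mulr0 pmulr_rle0 ?ltr0n; last by lia.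
  by rewrite normr_le0 => /eqP ->; rewrite normr0.
have wR : (n.+1 - hamming_weight w)%:R = n%:R + 1 - (hamming_weight w)%:R :> R.
  by rewrite natrB ?natr1 //; lia.
have [w4|w4] := eqVneq (hamming_weight w) 4.
  have := @nu_recursion w (n%:R - 1)^-1; rewrite wR w4 /= => /(_ isT) h.
  have {}h := h (fun v hv => nu_weight2 (succn_inj (succn_inj hv))).
  have p3 : 0 < n%:R - 3 :> R by lra.
  rewrite -(ler_pM2l p3).
  have -> : (n%:R - 3) * c4 = 3 * (n%:R - 1)^-1.
    by field; rewrite gt_eqF //=; lra.
  by rewrite (le_trans _ h) // (_ : n%:R + 1 - 4 = n%:R - 3) //; ring.
have w5 : (5 <= hamming_weight w)%N by move: w0 w2 w1 w3 w4; lia.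
have := @nu_recursion w c4; rewrite wR => h.
have {}h : (n%:R + 1 - (hamming_weight w)%:R) * `|nu w| <=
           (hamming_weight w).-1%:R * c4.
  by apply: h => [|v hv]; [lia|apply: IH; lia].
have p1 : 0 < n%:R + 1 - (hamming_weight w)%:R :> R.
  by rewrite -wR ltr0n; lia.
rewrite -(ler_pM2l p1) (le_trans h) // ler_wpM2r // -wR ler_nat; lia.
Qed.

(** Apart from the poles [0] and [ones], only these vectors may have [nu] of order 1/n. The second
    condition means weight n - 2. *)
Definition near_poles : {set V} :=
  [set z | (hamming_weight z == 2) || (hamming_weight (z + ones) == 2)].

(** Complementation preserves [|nu|], so the weight may be taken to be at most n/2. *)
Lemma nu_far w : w != 0 -> w != ones -> w \notin near_poles -> `|nu w| <= c4.
Proof.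
rewrite -hamming_weight_eq0 -hamming_weight_eqn inE negb_or hamming_weight_ones.
move=> w0 wn /andP[w2 wn2]; have hle := hamming_weight_le w.
have [h|h] := leqP (hamming_weight w).*2 n.
  by apply: nu_low_weight => //; lia.
rewrite -normr_nu_ones; apply: nu_low_weight; rewrite hamming_weight_ones; lia.
Qed.

Lemma nu_nontrivial w : w != 0 -> w != ones -> `|nu w| <= (n%:R - 1)^-1.
Proof.
have n1 : 6 <= n%:R :> R by rewrite ler_nat.
move=> w0 w1; have [|wD] := boolP (w \in near_poles).
  rewrite inE => /orP[] /eqP h; first exact: nu_weight2.
  by rewrite -normr_nu_ones; exact: nu_weight2.
(* The comparison amounts to 3 <= n - 3, which is where n >= 6 enters. *)
rewrite (le_trans (nu_far w0 w1 wD)) //.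
rewrite ler_pdivrMr ?mulrA ?mulVf ?mul1r; [lra|rewrite gt_eqF; lra|].
by apply: mulr_gt0; lra.
Qed.
End Slice.

(** The square of C(2m, m) >= 4^m / (2 sqrt m), an equality at m = 1. Consecutive central
    coefficients have ratio 2(2m + 1)/(m + 1), so the induction step reduces to 4m(m + 1) <= (2m +
    1)^2. *)
Lemma central_bin_lb (m : nat) :
  (0 < m)%N -> (16 ^ m <= 4 * m * 'C(m.*2, m) ^ 2)%N.
Proof.
case: m => // m _; elim: m => // m IH.
have e1 := mul_bin_diag m.+2.*2 m.+1; have e2 := mul_bin_down m.+1.*2.+1 m.+1.
rewrite /= in e1 e2.
have {}e2 : ((2 * m + 3) * 'C(m.+1.*2, m.+1) = (m + 2) * 'C(m.+1.*2.+1, m.+1))%N.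
  move: e2; rewrite (_ : m.*2.+3 - m.+1 = m + 2)%N; last by lia.
  by move=> <-; congr (_ * _)%N; lia.
have {}e1 : ('C(m.+2.*2, m.+2) = 2 * 'C(m.+1.*2.+1, m.+1))%N.
  apply/eqP; rewrite -(eqn_pmul2l (ltn0Sn m.+1)); apply/eqP.
  by rewrite -e1 /=; move: 'C(_, _) => c; lia.
rewrite e1 expnS; move: IH e2.
move: 'C(_, _) 'C(_, _) (16 ^ _)%N => b a c IH e2.
have p : (0 < (m + 2))%N by lia.
(* With the factor [m.+2] already on the right, this completes the square of [(m + 2) * b], which
   [e2] rewrites in terms of [a]. *)
rewrite -(leq_pmul2l p).
apply: (@leq_trans ((m + 2) * (16 * (4 * m.+1 * a ^ 2)))%N).
  by rewrite !leq_mul2l IH !orbT.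
have -> : ((m + 2) * (4 * m.+2 * (2 * b) ^ 2) = 16 * ((m + 2) * b) ^ 2)%N.
  by rewrite !expnMn; lia.
rewrite -e2 expnMn; nia.
Qed.

(** * Large and small coefficients *)

Section Codegree.
Variable n : nat.
Local Notation V := 'rV['F_2]_n.
Local Notation e := (delta_mx 0).
Local Notation ones := (const_mx 1 : V).
Local Notation P2 := [set a : V | hamming_weight a == 2].
Implicit Types (a z : V) (i : 'I_n).

Lemma weight2_at a i :
  a \in P2 -> a 0 i != 0 -> a \in [set e i + e l | l : 'I_n].
Proof.
rewrite inE => /eqP ha ai; have := hamming_weight_delta ai; rewrite ha.
move/hamming_weight_eq1 => [l al]; apply/imsetP; exists l => //.
by rewrite addrC -al addrK_F2.
Qed.

Lemma exists_neq0 z : z != 0 -> exists i, z 0 i != 0.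
Proof.
by rewrite -hamming_weight_eq0 -lt0n => /card_gt0P[i]; rewrite inE; exists i.
Qed.

Lemma card_image_ord (W : finType) (F : 'I_n -> W) :
  (#|[set F l | l : 'I_n]| <= n)%N.
Proof. by rewrite (leq_trans (leq_imset_card _ _)) // card_ord. Qed.

Lemma card_weight2 : (#|P2| <= n ^ 2)%N.
Proof.
have sub : P2 \subset [set e i.1 + e i.2 | i : 'I_n * 'I_n].
  apply/subsetP => a aP; have [|i ai] := @exists_neq0 a.
    by rewrite -hamming_weight_eq0; move: aP; rewrite inE => /eqP ->.
  have /imsetP[l _ ->] := weight2_at aP ai.
  by apply/imsetP; exists (i, l).
rewrite (leq_trans (subset_leq_card sub)) // (leq_trans (leq_imset_card _ _)) //.
by rewrite card_prod card_ord.
Qed.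

(** Its size is the number of common neighbours of two vertices differing by [z] in the Cayley graph
    generated by [A]. *)
Definition self_overlap (A : {set V}) z : {set V} :=
  [set a in A | a + z \in A].

(* A coordinate in the support of [z] lies in the support of [a] or [a + z]. *)
Lemma codegree_weight2 z :
  z != 0 -> (#|self_overlap P2 z| <= 2 * n)%N.
Proof.
move=> /exists_neq0[i zi].
have sub : self_overlap P2 z \subset
    [set e i + e l | l : 'I_n] :|: [set e i + e l + z | l : 'I_n].
  apply/subsetP => a /setIdP[aP azP]; rewrite inE.
  have [ai|ai] := eqVneq (a 0 i) 0; last by rewrite weight2_at.
  have /imsetP[l _ al] : a + z \in [set e i + e l | l : 'I_n].
    by apply: weight2_at => //; rewrite mxE ai add0r.
  by apply/orP; right; apply/imsetP; exists l => //; rewrite -al addrK_F2.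
rewrite (leq_trans (subset_leq_card sub)) // (leq_trans (leq_card_setU _ _)) //.
by rewrite mul2n -addnn leq_add // card_image_ord.
Qed.

Lemma card_near_poles : (#|near_poles n| <= 2 * n ^ 2)%N.
Proof.
have sub : near_poles n \subset P2 :|: [set a + ones | a in P2].
  apply/subsetP => a; rewrite !inE => /orP[->//|h]; apply/orP; right.
  by apply/imsetP; exists (a + ones); rewrite ?inE // addrK_F2.
rewrite (leq_trans (subset_leq_card sub)) // (leq_trans (leq_card_setU _ _)) //.
rewrite mul2n -addnn leq_add ?card_weight2 //.
by rewrite (leq_trans (leq_imset_card _ _)) // card_weight2.
Qed.

(** Each of [a] and [a + z] has weight 2 or n - 2. Complementing where needed turns the four cases
    into codegrees for weight 2 at [z] or [z + ones], both nonzero, at a cost of 2n each. *)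
Lemma codegree_near_poles z : z != 0 -> z != ones ->
  (#|self_overlap (near_poles n) z| <= 8 * n)%N.
Proof.
move=> z0 z1; pose C := self_overlap P2.
have z1' : z + ones != 0 by rewrite addr_eq0_F2.
have sub : self_overlap (near_poles n) z \subset
    (C z :|: C (z + ones)) :|:
    ([set a + ones | a in C z] :|: [set a + ones | a in C (z + ones)]).
  have hC a w : (a + ones \in C w) -> a \in [set a + ones | a in C w].
    by move=> h; apply/imsetP; exists (a + ones); rewrite // addrK_F2.
  apply/subsetP => a; rewrite [in X in X -> _]inE ![_ \in near_poles _]inE.
  rewrite !in_setU.
  move=> /andP[/orP[] h1 /orP[] h2]; apply/orP.
  - by left; apply/orP; left; rewrite !inE h1.
  - by left; apply/orP; right; rewrite !inE h1 addrA.
  - right; apply/orP; right; apply: hC.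
    by rewrite !inE h1 addrACA addrr_F2 addr0.
  - by right; apply/orP; left; apply: hC; rewrite !inE h1 addrAC.
rewrite (leq_trans (subset_leq_card sub)) // (leq_trans (leq_card_setU _ _)) //.
have c1 : (#|C z| <= 2 * n)%N := codegree_weight2 z0.
have c2 : (#|C (z + ones)%R| <= 2 * n)%N := codegree_weight2 z1'.
have im w : (#|C w| <= 2 * n)%N -> (#|[set (a + ones)%R | a in C w]| <= 2 * n)%N.
  exact: leq_trans (leq_imset_card _ _).
rewrite (_ : 8 * n = (2 * n + 2 * n) + (2 * n + 2 * n))%N; last by lia.
apply: leq_add; apply: (leq_trans (leq_card_setU _ _)).
  exact: leq_add.
by apply: leq_add; apply: im.
Qed.
End Codegree.

(** * Duality bounds with the poles separated *)

Section Sieve.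
Variables (R : realFieldType) (n : nat).
Local Notation V := 'rV['F_2]_n.
Local Notation ones := (const_mx 1 : V).
Local Notation T := (middle_slice n).
Local Notation D := (near_poles n).
Implicit Types (u v w z : V) (b beta : V -> R).

Lemma sum_pick u z (F : V -> R) : \sum_v (u + v == z)%:R * F v = F (u + z).
Proof.
rewrite (bigD1 (u + z)) //= addKr_F2 eqxx mul1r big1 ?addr0 // => v vz.
suff -> : (u + v == z) = false by rewrite mul0r.
by apply: contraNF vz => /eqP <-; rewrite addKr_F2.
Qed.

(** Let [t w] be the [beta]-mass of the neighbours of [w]. Cauchy-Schwarz bounds the square by p c
    times the sum of t^2, which counts common neighbours of pairs [u], [v]: at most 8n in general,
    and at most 2n^2 when [v] is [u] or its complement. *)
Lemma near_poles_energy beta (p c : R) :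
  (forall u, 0 <= beta u) -> (forall u, beta u <= c) -> \sum_u beta u <= p ->
  (\sum_u \sum_v beta u * beta v * (u + v \in D)%:R) ^+ 2 <=
    p * c * (8 * n%:R * p ^+ 2 + 4 * n%:R ^+ 2 * c * p).
Proof.
move=> b0 bc bp; pose t w := \sum_u beta u * (w + u \in D)%:R.
have s0 : 0 <= \sum_u beta u by apply: sumr_ge0.
have p0 : 0 <= p := le_trans s0 bp.
have c0 : 0 <= c := le_trans (b0 0) (bc 0).
have -> : \sum_u \sum_v beta u * beta v * (u + v \in D)%:R =
    \sum_u beta u * t u.
  apply: eq_bigr => u _; rewrite /t mulr_sumr.
  by apply: eq_bigr => v _; rewrite mulrA.
apply: le_trans (jensen_sqr _ _ b0) _.
have t2 : \sum_w t w ^+ 2 <= 8 * n%:R * p ^+ 2 + 4 * n%:R ^+ 2 * c * p.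
  have -> : \sum_w t w ^+ 2 = \sum_u \sum_v beta u * beta v *
      #|self_overlap D (u + v)|%:R.
    have -> : \sum_w t w ^+ 2 = \sum_w \sum_u \sum_v beta u * beta v *
        ((w + u \in D) && (w + v \in D))%:R.
      apply: eq_bigr => w _; rewrite expr2 big_distrlr /=.
      apply: eq_bigr => u _; apply: eq_bigr => v _.
      by rewrite -mulnb natrM; ring.
    rewrite exchange_big; apply: eq_bigr => u _ /=.
    rewrite exchange_big; apply: eq_bigr => v _ /=.
    rewrite -mulr_sumr -natr_sum -sum1dep_card [in RHS]big_mkcond /=.
    (* Translating [w] by [u] replaces [w + u] and [w + v] by [w] and [w + (u + v)]. *)
    rewrite -(sum_addr (fun w => _) u); congr (_ * _%:R); apply: eq_bigr => w _.
    by rewrite addrK_F2 -addrA; case: ifP.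
  have cg z : #|self_overlap D z|%:R <= 8 * n%:R +
      2 * n%:R ^+ 2 * ((z == 0)%:R + (z == ones)%:R) :> R.
    have n0 : 0 <= n%:R :> R by [].
    have big : #|self_overlap D z|%:R <= 2 * n%:R ^+ 2 :> R.
      rewrite -natrX -natrM ler_nat (leq_trans _ (card_near_poles n)) //.
      by apply: subset_leq_card; apply/subsetP => a /setIdP[].
    have nn : 0 <= n%:R ^+ 2 :> R := sqr_ge0 _.
    have [z0|z0] := eqVneq z 0.
      by rewrite (le_trans big) //; case: (z == ones); rewrite /=; lra.
    have [z1|z1] := eqVneq z ones; first by rewrite (le_trans big) //=; lra.
    rewrite addr0 mulr0 addr0 -natrM ler_nat; exact: codegree_near_poles.
  apply: (@le_trans _ _ (\sum_u \sum_v (8 * n%:R * (beta u * beta v) +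
      (2 * n%:R ^+ 2 * beta u * ((u + v == 0)%:R * beta v) +
       2 * n%:R ^+ 2 * beta u * ((u + v == ones)%:R * beta v))))).
    apply: ler_sum => u _; apply: ler_sum => v _.
    rewrite (le_trans (ler_wpM2l _ (cg (u + v)))) ?mulr_ge0 //.
    by rewrite le_eqVlt; apply/orP; left; apply/eqP; ring.
  under eq_bigr => u _ do rewrite !big_split /= -!mulr_sumr !sum_pick addr0.
  rewrite !big_split /= -!mulr_sumr -mulr_suml.
  have hb : forall z, \sum_u 2 * n%:R ^+ 2 * beta u * beta (u + z) <=
      2 * n%:R ^+ 2 * c * p.
    move=> z; apply: (@le_trans _ _ (\sum_u 2 * n%:R ^+ 2 * c * beta u)).
      apply: ler_sum => u _; rewrite mulrAC ler_wpM2r // ler_wpM2l //.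
      by rewrite mulr_ge0 // sqr_ge0.
    by rewrite -mulr_sumr ler_wpM2l // !mulr_ge0 // sqr_ge0.
  have h1 := hb ones.
  have h0 : \sum_u 2 * n%:R ^+ 2 * beta u * beta u <= 2 * n%:R ^+ 2 * c * p.
    by apply: le_trans (hb 0); apply: ler_sum => u _; rewrite addr0.
  have : 8 * n%:R * ((\sum_u beta u) * \sum_u beta u) <= 8 * n%:R * p ^+ 2.
    by rewrite ler_wpM2l ?mulr_ge0 // expr2 ler_pM.
  lra.
rewrite -mulrA ler_pM //.
  by apply: sumr_ge0 => u _; rewrite mulr_ge0 ?sqr_ge0.
rewrite (le_trans _ (ler_wpM2l c0 t2)) // mulr_sumr ler_sum // => u _.
by rewrite ler_wpM2r ?sqr_ge0.
Qed.

Definition nontrivial_nu z : R :=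
  if (z == 0) || (z == ones) then 0 else `|nu R z|.

(** In [coef_dual], the pairs with [u + v] equal to [0] or to [ones] contribute at most the sum of
    b^2 for each pole, by the inequality of means. *)
Lemma coef_dual_nontrivial (F b : V -> R) : (forall x, F x * F x = 1) ->
  (\sum_u b u * coef T F u) ^+ 2 <=
    2 * \sum_u b u ^+ 2 +
    \sum_u \sum_v `|b u| * `|b v| * nontrivial_nu (u + v).
Proof.
move=> F1; apply: le_trans (coef_dual b F1 (middle_slice_gt0 n)) _.
apply: (@le_trans _ _ (\sum_u \sum_v ((`|b u| * `|b v| * nontrivial_nu (u + v)) +
  ((u + v == 0)%:R * ((b u ^+ 2 + b v ^+ 2) / 2) +
   (u + v == ones)%:R * ((b u ^+ 2 + b v ^+ 2) / 2))))).
  apply: ler_sum => u _; apply: ler_sum => v _.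
  rewrite -/(nu R (u + v)); apply: le_trans (ler_norm _) _.
  rewrite (normrM (b u * b v)) (normrM (b u)).
  have s0 : 0 <= (b u ^+ 2 + b v ^+ 2) / 2.
    by rewrite divr_ge0 // addr_ge0 // sqr_ge0.
  rewrite /nontrivial_nu; case: ifP => [h|/negbT]; last first.
    by rewrite negb_or => /andP[/negPf -> /negPf ->]; rewrite !mul0r !addr0 lexx.
  rewrite mulr0 add0r; have n1 : `|nu R (u + v)| <= 1.
    by apply: coef_le1 (middle_slice_gt0 n) => x; rewrite mulr1.
  have ag : `|b u| * `|b v| <= (b u ^+ 2 + b v ^+ 2) / 2.
    have := sqr_ge0 (`|b u| - `|b v|); rewrite -(real_normK (num_real (b u))).
    by rewrite -(real_normK (num_real (b v))); lra.
  apply: (@le_trans _ _ ((b u ^+ 2 + b v ^+ 2) / 2)).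
    by rewrite (le_trans _ ag) // ler_piMr // mulr_ge0.
  have le_nat k : 0 <= k%:R * ((b u ^+ 2 + b v ^+ 2) / 2) by rewrite mulr_ge0.
  by case/orP: h => ->; rewrite mul1r ?lerDl ?lerDr le_nat.
under eq_bigr => u _ do rewrite !big_split /= !sum_pick addr0.
rewrite !big_split /= addrC lerD2r -!mulr_suml !big_split /=.
by rewrite (sum_addr (fun u => b u ^+ 2)); lra.
Qed.

Hypotheses (n_even : ~~ odd n) (n_ge6 : (6 <= n)%N).

Lemma nontrivial_nu_le z : nontrivial_nu z <= (n%:R - 1)^-1.
Proof.
have n1 : 6 <= n%:R :> R by rewrite ler_nat.
rewrite /nontrivial_nu; case: ifP => [_|/negbT]; first by rewrite invr_ge0; lra.
by rewrite negb_or => /andP[z0 z1]; exact: nu_nontrivial.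
Qed.

Lemma nontrivial_nu_le2 z :
  nontrivial_nu z <= (n%:R - 1)^-1 * (z \in D)%:R + 3 / ((n%:R - 1) * (n%:R - 3)).
Proof.
have n1 : 6 <= n%:R :> R by rewrite ler_nat.
have c0 : 0 <= 3 / ((n%:R - 1) * (n%:R - 3)) :> R.
  by apply: divr_ge0 => //; apply: mulr_ge0; lra.
have [zD|zD] := boolP (z \in D).
  by rewrite mulr1 (le_trans (nontrivial_nu_le z)) // lerDl.
rewrite mulr0 add0r /nontrivial_nu; case: ifP => [//|/negbT].
by rewrite negb_or => /andP[z0 z1]; exact: nu_far.
Qed.

Variables (F : V -> R) (eps : R).
Hypotheses (F1 : forall x, F x * F x = 1) (eps0 : 0 < eps).
Local Notation g := (coef T F).
Local Notation p := (2 ^+ n / #|T|%:R : R).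

(** Take [b] to be [g] on the large coefficients. There [|g| <= g^2 / eps], so the sum of [|b|] is
    at most [A / eps]; duality gives A^2 <= 2A + (A / eps)^2 / (n - 1), and dividing by [A]
    concludes. *)
Lemma large_coef_energy (A := \sum_(u | eps <= `|g u|) g u ^+ 2) :
  A <= 2 + A / (eps ^+ 2 * (n%:R - 1)).
Proof.
have n1 : 6 <= n%:R :> R by rewrite ler_nat.
have A0 : 0 <= A by apply: sumr_ge0 => u _; rewrite sqr_ge0.
pose b u := if eps <= `|g u| then g u else 0.
have hA : \sum_u b u ^+ 2 = A.
  rewrite /A [RHS]big_mkcond; apply: eq_bigr => u _; rewrite /b.
  by case: ifP; rewrite ?expr0n.
have := coef_dual_nontrivial b F1.
rewrite hA (_ : \sum_u b u * g u = A); last first.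
  rewrite /A [RHS]big_mkcond; apply: eq_bigr => u _; rewrite /b.
  by case: ifP; rewrite ?mul0r.
have bA : \sum_u `|b u| <= A / eps.
  rewrite -hA mulr_suml; apply: ler_sum => u _; rewrite ler_pdivlMr // /b.
  case: ifP => h; last by rewrite normr0 mul0r sqr_ge0.
  by rewrite -real_normK ?num_real // expr2 ler_wpM2l.
have : \sum_u \sum_v `|b u| * `|b v| * nontrivial_nu (u + v) <=
    A / eps * (A / eps) * (n%:R - 1)^-1.
  apply: (@le_trans _ _ (\sum_u \sum_v `|b u| * `|b v| * (n%:R - 1)^-1)).
    apply: ler_sum => u _; apply: ler_sum => v _.
    by rewrite ler_wpM2l ?mulr_ge0 // nontrivial_nu_le.
  under eq_bigr => u _ do rewrite -mulr_suml -mulr_sumr.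
  rewrite -!mulr_suml; apply: ler_wpM2r; first by rewrite invr_ge0; lra.
  by apply: ler_pM => //; apply: sumr_ge0.
have [->|An0] := eqVneq A 0; first by rewrite mul0r; lra.
have Ap : 0 < A by rewrite lt_neqAle eq_sym An0.
move=> h1 h2; rewrite -(ler_pM2l Ap) -expr2 (le_trans h2) // mulrDr.
rewrite [A * 2]mulrC lerD2l (le_trans h1) // le_eqVlt; apply/orP; left.
by apply/eqP; field; rewrite !gt_eqF //; lra.
Qed.

(** Take [b = g |g|] on the small coefficients: [b g] is [|g|^3], while [|b| = g^2] is at most
    [eps^2] and has sum at most [p] by Parseval. [Q] is the contribution of [near_poles], bounded
    through its square to avoid a root. *)
Lemma small_coef_cubes (X := \sum_(u | `|g u| < eps) `|g u| ^+ 3) :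
  exists2 Q : R,
    0 <= Q /\ Q ^+ 2 <= p * eps ^+ 2 *
      (8 * n%:R * p ^+ 2 + 4 * n%:R ^+ 2 * eps ^+ 2 * p) &
    X ^+ 2 <= 2 * (eps ^+ 2 * p) +
      ((n%:R - 1)^-1 * Q + 3 / ((n%:R - 1) * (n%:R - 3)) * p ^+ 2).
Proof.
have n1 : 6 <= n%:R :> R by rewrite ler_nat.
pose b u := if `|g u| < eps then g u * `|g u| else 0.
pose be u := `|b u|.
have be0 u : 0 <= be u by rewrite /be.
have beE u : be u = if `|g u| < eps then g u ^+ 2 else 0.
  rewrite /be /b; case: ifP => _; last by rewrite normr0.
  by rewrite normrM normr_id -expr2 real_normK ?num_real.
have bec u : be u <= eps ^+ 2.
  rewrite beE; case: ifP => h; last by rewrite sqr_ge0.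
  by rewrite -real_normK ?num_real // lerXn2r ?nnegrE ?normr_ge0 ?ltW.
have bep : \sum_u be u <= p.
  rewrite -(parseval F1 (middle_slice_gt0 n)); apply: ler_sum => u _.
  by rewrite beE; case: ifP; rewrite ?sqr_ge0.
have p0 : 0 <= p by rewrite divr_ge0 ?exprn_ge0.
exists (\sum_u \sum_v be u * be v * (u + v \in D)%:R).
  split; last exact: near_poles_energy.
  by apply: sumr_ge0 => u _; apply: sumr_ge0 => v _; rewrite !mulr_ge0.
have := coef_dual_nontrivial b F1.
have -> : \sum_u b u * g u = X.
  rewrite /X [RHS]big_mkcond; apply: eq_bigr => u _; rewrite /b.
  case: ifP; rewrite ?mul0r // => _; rewrite mulrAC -expr2.
  by rewrite -[in LHS](real_normK (num_real (g u))) -exprSr.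
move=> h; apply: (le_trans h); apply: lerD.
  rewrite ler_wpM2l //; apply: (@le_trans _ _ (\sum_u eps ^+ 2 * be u)).
    apply: ler_sum => u _; rewrite -(real_normK (num_real (b u))) expr2.
    exact: (ler_wpM2r (be0 u) (bec u)).
  by rewrite -mulr_sumr ler_wpM2l // sqr_ge0.
apply: (@le_trans _ _ (\sum_u \sum_v ((n%:R - 1)^-1 *
    (be u * be v * (u + v \in D)%:R) +
    3 / ((n%:R - 1) * (n%:R - 3)) * (be u * be v)))).
  apply: ler_sum => u _; apply: ler_sum => v _.
  rewrite (le_trans (ler_wpM2l _ (nontrivial_nu_le2 (u + v)))) ?mulr_ge0 //.
  by rewrite le_eqVlt; apply/orP; left; apply/eqP; rewrite /be; ring.
under eq_bigr => u _ do rewrite big_split /= -!mulr_sumr.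
rewrite big_split /= -!mulr_sumr lerD2l -mulr_suml ler_wpM2l //.
  by apply: divr_ge0 => //; apply: mulr_ge0; lra.
by rewrite expr2 ler_pM // sumr_ge0.
Qed.
End Sieve.

(** * The test *)

(** By [central_bin_lb] the square of the left side is at most 2n; [q ^+ 12] stands for the square
    root of n. *)
Lemma slice_density_le (R : realFieldType) (n : nat) (q : R) :
  ~~ odd n -> (0 < n)%N -> 0 <= q -> n%:R <= q ^+ 24 ->
  2 ^+ n / #|middle_slice n|%:R <= 2 * q ^+ 12.
Proof.
move=> n_even n0 q0 nq; have T0 := middle_slice_gt0 n.
have nE : n = n./2.*2 by rewrite -[LHS]odd_double_half (negPf n_even).
rewrite -(ler_pXn2r (isT : (0 < 2)%N)) ?nnegrE ?mulr_ge0 ?exprn_ge0 ?invr_ge0 //.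
rewrite expr_div_n ler_pdivrMr ?exprn_gt0 ?ltr0n // exprMn -exprM -exprM.
have cb : (16 ^ n./2 <= 4 * n./2 * #|middle_slice n| ^ 2)%N.
  rewrite card_middle_slice [X in 'C(X, _)]nE; apply: central_bin_lb; lia.
have {}cb : 16 ^+ n./2 <= 4 * (n./2)%:R * #|middle_slice n|%:R ^+ 2 :> R.
  by rewrite -!natrX -!natrM ler_nat.
have -> : 2 ^+ (n * 2) = 16 ^+ n./2 :> R.
  rewrite (_ : n * 2 = 4 * n./2)%N; last by lia.
  by rewrite exprM; congr (_ ^+ _); ring.
apply: (le_trans cb); rewrite ler_wpM2r ?exprn_ge0 //.
have : 2 * (n./2)%:R = n%:R :> R by rewrite -natrM mul2n -nE.
have : 0 <= (n./2)%:R :> R by [].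
by lra.
Qed.

Section Test.
Variables (R : realType) (n k : nat).
Local Notation V := 'rV['F_2]_n.
Local Notation ones := (const_mx 1 : V).
Local Notation T := (middle_slice n).
Implicit Types (f : V -> 'F_2) (u : V).

Definition signed f (x : V) : R := F2sign R (f x).

Lemma signed_sqr f x : signed f x * signed f x = 1.
Proof. exact: F2sign_sqr. Qed.

Lemma unif_prob_le1 (U : finType) (A : {set U}) (P : pred U) :
  unif_prob R A P <= 1.
Proof.
rewrite /unif_prob; have [->|A0] := eqVneq #|A| 0%N.
  by rewrite invr0 mulr0.
rewrite ler_pdivrMr ?ltr0n ?lt0n // mul1r ler_nat subset_leq_card //.
by apply/subsetP => x /setIdP[].
Qed.

Lemma unif_prob_ge0 (U : finType) (A : {set U}) (P : pred U) :
  0 <= unif_prob R A P.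
Proof. by rewrite /unif_prob divr_ge0. Qed.

Lemma sum_sign_unif_prob (U : finType) (A : {set U}) (P : pred U) :
  \sum_(x in A) (if P x then 1 else -1) =
    #|A|%:R * (2 * unif_prob R A P - 1) :> R.
Proof.
have -> : #|A|%:R * (2 * unif_prob R A P - 1) =
    2 * #|[set x in A | P x]|%:R - #|A|%:R.
  (* For empty [A] both sides are 0, whatever value the quotient takes. *)
  rewrite /unif_prob; have [A0|A0] := eqVneq #|A| 0%N.
    have -> : [set x in A | P x] = set0.
      by apply/setP => x; rewrite !inE (card0_eq A0) //= .
    by rewrite A0 cards0; ring.
  by field; rewrite pnatr_eq0.
rewrite -!sum1_card !natr_sum mulr_sumr big_mkcond [X in _ = X - _]big_mkcond.
rewrite [X in _ = _ - X]big_mkcond -sumrB /=; apply: eq_bigr => x _.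
by rewrite inE; case: (x \in A) => /=; case: (P x); ring.
Qed.

(** By [coef_moment] both moments are the same multiple of a sum over the samples: of acceptance
    signs for [f], of ones for [nu]. The product form also covers an empty set of samples. *)
Lemma coef_moment_blr f : (0 < k)%N ->
  \sum_u coef T (signed f) u ^+ k =
    (2 * blr_pass_prob R k T f - 1) * \sum_(u : V) nu R u ^+ k.
Proof.
move=> k0; have T0 := middle_slice_gt0 n.
rewrite /nu !coef_moment // mulrCA; congr (_ * _).
rewrite [X in _ = _ * X](_ : _ = #|blr_samples k T|%:R); last first.
  by rewrite -sumr_const; apply: eq_bigr => x _; rewrite big1_eq mulr1.
rewrite mulrC -sum_sign_unif_prob; apply: eq_bigr => x _.
rewrite /signed -F2sign_sum -F2signD /blr_accepts.
case: (F2_cases (f (\sum_i x i))) => ->;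
  case: (F2_cases (\sum_i f (x i))) => -> //=.
Qed.

(** The bit [b] is chosen so that its sign is the sign of the coefficient. *)
Lemma agreement f u :
  exists b, unif_prob R T (fun x => f x == dotp u x + b) =
    (1 + `|coef T (signed f) u|) / 2.
Proof.
have H b : F2sign R b * coef T (signed f) u =
    2 * unif_prob R T (fun x => f x == dotp u x + b) - 1.
  have T0 : #|T|%:R != 0 :> R by rewrite pnatr_eq0 -lt0n middle_slice_gt0.
  apply: (mulfI T0); rewrite -sum_sign_unif_prob /coef mulrCA [_ / _]mulrC.
  rewrite mulVKf // mulr_sumr; apply: eq_bigr => x _.
  rewrite /signed /chi -!F2signD.
  case: (F2_cases (f x)) => ->; case: (F2_cases (dotp u x)) => ->;
  case: (F2_cases b) => -> //=.
have [h|h] := leP 0 (coef T (signed f) u).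
  by exists 0; rewrite ger0_norm //; have := H 0; rewrite F2sign0; lra.
by exists 1; rewrite ltr0_norm //; have := H 1; rewrite F2sign1; lra.
Qed.

Hypotheses (n_even : ~~ odd n) (n_ge6 : (6 <= n)%N) (k_ge3 : (3 <= k)%N).

(** Each pole contributes 1, the parity hypothesis making the sign at [ones] disappear. Any other
    term is at least -nu^2 / (n - 1), and Parseval sums these. *)
Lemma nu_moment_ge : ~~ odd k || ~~ odd n./2 ->
  2 - 2 ^+ n / #|T|%:R / (n%:R - 1) <= \sum_(u : V) nu R u ^+ k.
Proof.
move=> par; have T0 := middle_slice_gt0 n.
have n1 : 6 <= n%:R :> R by rewrite ler_nat.
have i0 : 0 <= (n%:R - 1)^-1 :> R by rewrite invr_ge0; lra.
have -> : 2 ^+ n / #|T|%:R = \sum_(u : V) nu R u ^+ 2.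
  by rewrite /nu parseval // => x; rewrite mulr1.
apply: (@le_trans _ _ (\sum_u (((0 + u == 0)%:R * 1 + (0 + u == ones)%:R * 1) -
    nu R u ^+ 2 * (n%:R - 1)^-1))).
  by rewrite sumrB big_split /= !(sum_pick _ _ (fun=> 1)) mulr_suml; lra.
apply: ler_sum => u _; rewrite add0r !mulr1.
have ones0 : ones != 0.
  have /eqP h : hamming_weight ones == n by rewrite hamming_weight_eqn.
  by rewrite -hamming_weight_eq0 h; lia.
have s0 : 0 <= nu R u ^+ 2 * (n%:R - 1)^-1 by rewrite mulr_ge0 ?sqr_ge0.
have [u0|u0] := eqVneq u 0.
  move: s0; rewrite u0 [0 == ones]eq_sym (negPf ones0) nu0 !expr1n /=; lra.
have [u1|u1] := eqVneq u ones.
  move: s0; rewrite u1 nu_ones -(exprM _ _ k) -(signr_odd _ (_ * k)) oddM.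
  have -> : odd n./2 && odd k = false.
    by rewrite -[LHS]negbK negb_and orbC par.
  by rewrite expr0 /=; lra.
rewrite /= addr0 add0r; have : `|nu R u ^+ k| <= nu R u ^+ 2 * (n%:R - 1)^-1.
  (* As [|nu| <= 1], the k-th power is at most the cube; one factor of the cube supplies 1/(n -
     1). *)
  rewrite normrX (_ : k = (k - 3) + 3)%N; last by lia.
  rewrite exprD [_ ^+ 3]exprSr real_normK ?num_real //.
  have nu1 : `|nu R u| <= 1 by apply: coef_le1 => // x; exact: mulr1.
  apply: (@le_trans _ _ (1 * (nu R u ^+ 2 * `|nu R u|))).
    apply: ler_wpM2r; last exact: exprn_ile1.
    by apply: mulr_ge0 => //; exact: sqr_ge0.
  by rewrite mul1r ler_wpM2l ?sqr_ge0 // nu_nontrivial.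
by rewrite ler_norml => /andP[].
Qed.
End Test.

(* Here [N] is the dimension [n], [q = (n + 1)^(1/24)], and [eps = q^(-8)]. *)
Section Numerics.
Variables (R : realFieldType) (N q p : R).
Hypotheses (q_ge12 : 12 <= q) (N_def : N + 1 = q ^+ 24).
Hypotheses (p_ge0 : 0 <= p) (p_le : p <= 2 * q ^+ 12).

Let q_gt0 : 0 < q. Proof. by move: q_ge12; lra. Qed.

Let exprV_le1 m : q^-1 ^+ m <= 1.
Proof.
apply: exprn_ile1; first by rewrite invr_ge0 ltW.
by rewrite invf_le1 //; move: q_ge12; lra.
Qed.

Let exprV_ge0 m : 0 <= q^-1 ^+ m.
Proof. by rewrite exprn_ge0 // invr_ge0 ltW. Qed.

Let exprV_le a m : (a <= m)%N -> q^-1 ^+ m <= q^-1 ^+ a.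
Proof.
by move=> am; rewrite -(subnKC am) exprD ler_piMr.
Qed.

Let N_large : q ^+ 24 / 2 + 3 <= N.
Proof.
have : 12 <= q ^+ 24.
  by rewrite (le_trans q_ge12) // ler_eXnr //; move: q_ge12; lra.
by move: N_def; lra.
Qed.

Let N1 : 0 < N - 1.
Proof.
have : 0 < q ^+ 24 by rewrite exprn_gt0.
by move: N_large; lra.
Qed.

Let V1 : (N - 1)^-1 <= 2 * q^-1 ^+ 24.
Proof.
have q24 : 0 < q ^+ 24 by rewrite exprn_gt0.
rewrite exprVn -[leLHS]mul1r ler_pdivrMr // mulrAC ler_pdivlMr //.
by move: N_large; lra.
Qed.

Let V3 : 3 / ((N - 1) * (N - 3)) <= 12 * q^-1 ^+ 48.
Proof.
have q24 : 0 < q ^+ 24 by rewrite exprn_gt0.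
have N3 : 0 < N - 3 by move: N_large; lra.
have V3' : (N - 3)^-1 <= 2 * q^-1 ^+ 24.
  rewrite exprVn -[leLHS]mul1r ler_pdivrMr // mulrAC ler_pdivlMr //.
  by move: N_large; lra.
rewrite invfM (_ : 12 * _ = 3 * (2 * q^-1 ^+ 24 * (2 * q^-1 ^+ 24))).
  by rewrite ler_wpM2l // ler_pM // ?invr_ge0 ltW.
by rewrite (_ : 48 = 24 + 24)%N // exprD; ring.
Qed.

Lemma density_error : p / (N - 1) <= 4 * q^-1.
Proof.
apply: (@le_trans _ _ (2 * q ^+ 12 * (2 * q^-1 ^+ 24))).
  by rewrite ler_pM // invr_ge0 ltW.
have -> : 2 * q ^+ 12 * (2 * q^-1 ^+ 24) = 4 * q^-1 ^+ 12.
  by field; rewrite gt_eqF.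
by rewrite ler_wpM2l // -[leRHS]expr1 exprV_le.
Qed.

Lemma large_energy_error (A : R) : 0 <= A ->
  A <= 2 + A / ((q^-1 ^+ 8) ^+ 2 * (N - 1)) -> A <= 2 + 8 * q^-1.
Proof.
move=> A0 hA.
have {}hA : A <= 2 + A * (2 * q^-1 ^+ 8).
  apply: (le_trans hA); rewrite lerD2l ler_wpM2l // invfM.
  have -> : 2 * q^-1 ^+ 8 = ((q^-1 ^+ 8) ^+ 2)^-1 * (2 * q^-1 ^+ 24).
    by field; rewrite gt_eqF.
  by rewrite ler_wpM2l // invr_ge0 exprn_ge0.
have s1 : q^-1 ^+ 8 <= q^-1 by rewrite -[leRHS]expr1 exprV_le.
have s2 : q^-1 <= 12^-1 by rewrite lef_pV2 // posrE; lra.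
(* A crude bound first; inserting it in the error term gives the sharp one. *)
have A4 : A <= 4.
  have : A * (2 * q^-1 ^+ 8) <= A * 2^-1 by rewrite ler_wpM2l //; lra.
  lra.
have : A * (2 * q^-1 ^+ 8) <= 4 * (2 * q^-1).
  by apply: ler_pM => //; [rewrite mulr_ge0|rewrite ler_wpM2l].
lra.
Qed.

(** In powers of [q]: [N] is of order 24, [p] at most 12 and the squared threshold -16. Hence Q^2
    has order 44, and the terms of the bound on X^2 have orders -4, -2 and -24, with coefficients 4
    + 18 + 48 <= 11^2. *)
Lemma small_cubes_error (X Q : R) : 0 <= X -> 0 <= Q ->
  Q ^+ 2 <= p * (q^-1 ^+ 8) ^+ 2 *
    (8 * N * p ^+ 2 + 4 * N ^+ 2 * (q^-1 ^+ 8) ^+ 2 * p) ->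
  X ^+ 2 <= 2 * ((q^-1 ^+ 8) ^+ 2 * p) +
    ((N - 1)^-1 * Q + 3 / ((N - 1) * (N - 3)) * p ^+ 2) ->
  X <= 11 * q^-1.
Proof.
move=> X0 Q0 hQ hX.
have qge0 : 0 <= q := ltW q_gt0.
have q0 m : 0 <= q ^+ m by rewrite exprn_ge0 // ltW.
have qn0 : q != 0 by rewrite gt_eqF.
have N0 : 0 <= N by move: N_large (q0 24%N); lra.
have N3 : 0 <= N - 3 by move: N_large (q0 24%N); lra.
have Nq : N <= q ^+ 24 by move: N_def; lra.
have p2 : p ^+ 2 <= 4 * q ^+ 24.
  have -> : 4 * q ^+ 24 = (2 * q ^+ 12) ^+ 2 by ring.
  by apply: lerXn2r; rewrite ?nnegrE ?mulr_ge0 ?q0.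
have Q9 : Q <= 9 * q ^+ 22.
  rewrite -(ler_pXn2r (isT : (0 < 2)%N)) ?nnegrE ?mulr_ge0 //.
  apply: (le_trans hQ).
  apply: (@le_trans _ _ (2 * q ^+ 12 * (q^-1 ^+ 8) ^+ 2 *
     (8 * q ^+ 24 * (4 * q ^+ 24) +
      4 * (q ^+ 24) ^+ 2 * (q^-1 ^+ 8) ^+ 2 * (2 * q ^+ 12)))).
    have N2 : N ^+ 2 <= (q ^+ 24) ^+ 2 by rewrite lerXn2r ?nnegrE.
    have e0 : 0 <= (q^-1 ^+ 8) ^+ 2 := sqr_ge0 _.
    have pp0 : 0 <= p ^+ 2 := sqr_ge0 p.
    have NN0 : 0 <= N ^+ 2 := sqr_ge0 N.
    have f0 : 0 <= 8 * N by rewrite mulr_ge0.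
    have f1 : 0 <= 4 * N ^+ 2 by rewrite mulr_ge0.
    have f2 : 0 <= 4 * N ^+ 2 * (q^-1 ^+ 8) ^+ 2 := mulr_ge0 f1 e0.
    apply: ler_pM.
    - exact: mulr_ge0.
    - by apply: addr_ge0; apply: mulr_ge0.
    - exact: ler_wpM2r.
    - apply: lerD; apply: ler_pM => //; first exact: ler_wpM2l.
      by apply: ler_wpM2r => //; exact: ler_wpM2l.
  have -> : (9 * q ^+ 22) ^+ 2 = 81 * q ^+ 44 by ring.
  rewrite [leLHS](_ : _ = 64 * q ^+ 44 + 16 * q ^+ 40); last first.
    by field.
  have : q ^+ 40 <= q ^+ 44 by rewrite ler_eXn2l //; move: q_ge12; lra.
  by have := q0 44%N; lra.
rewrite -(ler_pXn2r (isT : (0 < 2)%N)) ?nnegrE ?mulr_ge0 ?invr_ge0 //.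
apply: (le_trans hX).
have h1 : (q^-1 ^+ 8) ^+ 2 * p <= 2 * q^-1 ^+ 4.
  have -> : 2 * q^-1 ^+ 4 = (q^-1 ^+ 8) ^+ 2 * (2 * q ^+ 12) by field.
  by rewrite ler_wpM2l ?sqr_ge0.
have h2 : (N - 1)^-1 * Q <= 18 * q^-1 ^+ 2.
  rewrite (_ : 18 * _ = 2 * q^-1 ^+ 24 * (9 * q ^+ 22)); last by field.
  by rewrite ler_pM // invr_ge0 ltW.
have h3 : 3 / ((N - 1) * (N - 3)) * p ^+ 2 <= 48 * q^-1 ^+ 24.
  rewrite (_ : 48 * _ = 12 * q^-1 ^+ 48 * (4 * q ^+ 24)); last by field.
  apply: ler_pM => //; first by rewrite divr_ge0 // mulr_ge0 //; lra.
  exact: sqr_ge0.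
have s4 : q^-1 ^+ 4 <= q^-1 ^+ 2 by rewrite exprV_le.
have s24 : q^-1 ^+ 24 <= q^-1 ^+ 2 by rewrite exprV_le.
have s2 := exprV_ge0 2; have -> : (11 * q^-1) ^+ 2 = 121 * q^-1 ^+ 2 by ring.
by lra.
Qed.
End Numerics.

Lemma large_coef_of_test (R : realType) (n k : nat) (f : 'rV['F_2]_n -> 'F_2)
    (delta q : R) :
  ~~ odd n -> (3 <= k)%N -> ~~ odd k || ~~ odd n./2 ->
  0 <= delta <= 1 -> blr_pass_prob R k (middle_slice n) f = (1 + delta) / 2 ->
  12 <= q -> n.+1%:R = q ^+ 24 ->
  exists u, delta <=
    `|coef (middle_slice n) (signed R f) u| ^+ (k - 2) + 12 / q.
Proof.
move=> n_even k3 par /andP[d0 d1] hpass q12 qn.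
have q0 : 0 < q by lra.
have N_def : n%:R + 1 = q ^+ 24 by rewrite natr1.
have n6 : (6 <= n)%N.
  rewrite -ltnS -(ltr_nat R) qn (@lt_le_trans _ _ q) //; first by lra.
  by rewrite ler_eXnr //; lra.
set g := coef _ (signed R f); have T0 := middle_slice_gt0 n.
have F1 := @signed_sqr R n f.
set p : R := 2 ^+ n / #|middle_slice n|%:R.
have p0 : 0 <= p by rewrite divr_ge0 ?exprn_ge0.
have pq : p <= 2 * q ^+ 12 by apply: slice_density_le => //; [lia|lra|lra].
(* The large coefficients need a threshold well above n^(-1/2), the small ones well below
   n^(-1/4). *)
pose eps := q^-1 ^+ 8; have eps0 : 0 < eps by rewrite exprn_gt0 ?invr_gt0.
case: (@Order.TotalTheory.arg_maxP _ _ _ 0 xpredT (fun u => `|g u|) isT) => u _ hu.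
exists u; set m := `|g u|.
have m1 : m <= 1 by apply: coef_le1.
have m0 : 0 <= m by rewrite /m.
have hA := large_coef_energy n_even n6 F1 eps0.
have [Q [Q0 hQ] hX] := small_coef_cubes n_even n6 F1 eps0.
rewrite -/g -/p in hA hQ hX.
move: hA hX; set A := \sum_(v | eps <= _) _; set X := \sum_(v | _ < eps) _.
move=> hA hX.
have A0 : 0 <= A by apply: sumr_ge0 => v _; rewrite sqr_ge0.
have X0 : 0 <= X by apply: sumr_ge0 => v _; rewrite exprn_ge0.
have {}hA := large_energy_error q12 N_def A0 hA.
have {}hX := small_cubes_error q12 N_def p0 pq X0 Q0 hQ hX.
have hp := density_error q12 N_def p0 pq.
have hnu : 2 - p / (n%:R - 1) <= \sum_(v : 'rV_n) nu R v ^+ k.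
  exact: nu_moment_ge.
have k0 : (0 < k)%N := ltnW (ltnW k3).
have := coef_moment_blr R f k0; rewrite -/g hpass.
rewrite (_ : 2 * _ - 1 = delta); last by lra.
(* On large coefficients all but two factors are bounded by the maximum [m]; on small ones
   [|g| <= 1] reduces the k-th power to the cube. *)
have : \sum_v g v ^+ k <= m ^+ (k - 2) * A + X.
  rewrite (bigID (fun v => eps <= `|g v|)) /=; apply: lerD.
    rewrite mulr_sumr; apply: ler_sum => v _; apply: (le_trans (ler_norm _)).
    rewrite normrX -{1}(subnK (ltnW k3)) exprD real_normK ?num_real //.
    apply: ler_wpM2r; first exact: sqr_ge0.
    by apply: lerXn2r; rewrite ?nnegrE //; exact: hu.
  rewrite /X; rewrite (eq_bigl (fun v => `|g v| < eps)); last first.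
    by move=> v; rewrite -ltNge.
  apply: ler_sum => v _; apply: (le_trans (ler_norm _)).
  by rewrite normrX ler_wiXn2l // coef_le1.
move=> h1 h2; rewrite h2 in h1.
have h3 : delta * (2 - p / (n%:R - 1)) <= m ^+ (k - 2) * A + X.
  by apply: le_trans h1; rewrite ler_wpM2l.
have h4 : delta * (p / (n%:R - 1)) <= 1 * (4 * q^-1).
  apply: ler_pM => //; apply: divr_ge0 => //.
  by rewrite subr_ge0 ler1n (leq_trans _ n6).
have mk0 : 0 <= m ^+ (k - 2) by rewrite exprn_ge0.
have mk1 : m ^+ (k - 2) <= 1 by rewrite exprn_ile1.
have h5 : m ^+ (k - 2) * A <= m ^+ (k - 2) * (2 + 8 * q^-1) by rewrite ler_wpM2l.
have h6 : m ^+ (k - 2) * (8 * q^-1) <= 1 * (8 * q^-1).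
  by rewrite ler_wpM2r // mulr_ge0 // invr_ge0 ltW.
have q10 : 0 < q^-1 by rewrite invr_gt0.
(* The errors 4/q, 8/q and 11/q add up to 23/q, and twice [12 / q] covers them. *)
lra.
Qed.

(** * Taking roots, and the final error term *)

Lemma exprD_ge (R : realDomainType) (a b : R) (m : nat) :
  0 <= a -> 0 <= b -> (0 < m)%N -> a ^+ m + b ^+ m <= (a + b) ^+ m.
Proof.
move=> a0 b0; case: m => // m _; elim: m => [|m IH]; first by rewrite !expr1.
have ab0 : 0 <= a + b by rewrite addr_ge0.
rewrite [leRHS]exprS (le_trans _ (ler_wpM2l ab0 IH)) //.
have := mulr_ge0 a0 (exprn_ge0 m.+1 b0); have := mulr_ge0 b0 (exprn_ge0 m.+1 a0).
by rewrite [a ^+ m.+2]exprS [b ^+ m.+2]exprS; lra.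
Qed.

Lemma powR_root (R : realType) (x : R) (m : nat) :
  0 <= x -> (0 < m)%N -> (x `^ m%:R^-1) ^+ m = x.
Proof.
move=> x0 m0; have mn0 : m%:R != 0 :> R by rewrite pnatr_eq0 -lt0n.
by rewrite -powR_mulrn ?powR_ge0 // -powRrM mulVf // powRr1.
Qed.

(** The root of order k - 2 of the error [12 / q] in [large_coef_of_test], with
    [q ^+ 24 = n + 1]. *)
Definition slice_error (R : realType) (n k : nat) : R :=
  (12 / n.+1%:R `^ 24%:R^-1) `^ (k%:R - 2)^-1.

Local Open Scope classical_set_scope.

Lemma slice_error_cvg0 (R : realType) (k : nat) : (3 <= k)%N ->
  slice_error R n k @[n --> \oo] --> (0 : R).
Proof.
move=> k3; have kR : 0 < k%:R - 2 :> R by rewrite subr_gt0 ltr_nat.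
apply/cvgr0Pnorm_lt => e e0; near=> n.
rewrite /slice_error ger0_norm ?powR_ge0 //.
have r0 : 0 < e `^ (k%:R - 2) by rewrite powR_gt0.
(* With [e] written as a root, monotonicity removes the outer exponent. *)
have -> : e = (e `^ (k%:R - 2)) `^ (k%:R - 2)^-1.
  by rewrite -powRrM mulfV ?gt_eqF // powRr1 // ltW.
have q0 : 0 < n.+1%:R `^ 24%:R^-1 :> R by rewrite powR_gt0.
apply: gt0_ltr_powR; rewrite ?invr_gt0 ?nnegrE ?divr_ge0 ?ltW //.
rewrite ltr_pdivrMr // mulrC -ltr_pdivrMr //.
rewrite -(@ltr_pXn2r _ 24) ?nnegrE ?divr_ge0 ?(ltW r0) ?(ltW q0) //.
rewrite powR_root // -[n.+1%:R]natr1 ltr_wpDr //.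
by near: n; exact: nbhs_infty_gtr.
Unshelve. all: by end_near.
Qed.

Theorem theorem1p1 (R : realType) :
  exists o1 : nat -> nat -> R,
    (forall k : nat, (3 <= k)%N -> o1 n k @[n --> \oo] --> (0 : R)) /\
    (forall (n k : nat) (f : 'rV['F_2]_n -> 'F_2) (delta : R),
      ~~ odd n -> (3 <= k)%N -> ~~ odd k || ~~ odd n./2 ->
      0 < delta ->
      blr_pass_prob R k (middle_slice n) f = (1 + delta) / 2 ->
      exists (u : 'rV['F_2]_n) (b : 'F_2),
        unif_prob R (middle_slice n) (fun x => f x == dotp u x + b) >=
          (1 + delta `^ (k%:R - 2)^-1) / 2 - o1 n k).
Proof.
exists (slice_error R); split; first exact: slice_error_cvg0.
move=> n k f delta n_even k3 par d0 hpass.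
have kR : k%:R - 2 = (k - 2)%:R :> R by rewrite natrB // ltnW.
have k2 : (0 < k - 2)%N by rewrite subn_gt0.
have kV : 0 <= (k%:R - 2)^-1 :> R by rewrite kR invr_ge0.
have d1 : delta <= 1.
  have := unif_prob_le1 R (blr_samples k (middle_slice n)) (@blr_accepts n k f).
  by rewrite -/(blr_pass_prob R k (middle_slice n) f) hpass; lra.
set q : R := n.+1%:R `^ 24%:R^-1.
have q0 : 0 < q by rewrite powR_gt0.
have [q12|q12] := leP 12 q; last first.
  (* For small [q] the error is at least 1, the required lower bound is at most 0, and any [u], [b]
     will do. *)
  exists 0, 0; apply: le_trans (unif_prob_ge0 _ _ _).
  have : delta `^ (k%:R - 2)^-1 <= 1 `^ (k%:R - 2)^-1.
    by apply: ge0_ler_powR; rewrite ?nnegrE // ltW.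
  have : 1 `^ (k%:R - 2)^-1 <= slice_error R n k.
    apply: ge0_ler_powR; rewrite ?nnegrE ?divr_ge0 ?(ltW q0) //.
    by rewrite -/q ler_pdivlMr // mul1r ltW.
  by rewrite powR1; lra.
have d01 : 0 <= delta <= 1 by rewrite ltW.
have qn : n.+1%:R = q ^+ 24 by rewrite powR_root.
have [u hu] := large_coef_of_test n_even k3 par d01 hpass q12 qn.
have [b hb] := agreement R f u.
exists u, b; rewrite hb; move: hu; set m := `|_| => hu.
have : delta `^ (k%:R - 2)^-1 <= m + slice_error R n k.
  have m0 : 0 <= m by rewrite /m.
  have s0 : 0 <= slice_error R n k by rewrite powR_ge0.
  have -> : m + slice_error R n k =
      ((m + slice_error R n k) ^+ (k - 2)) `^ (k%:R - 2)^-1.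
    rewrite -powR_mulrn ?addr_ge0 // -powRrM -kR mulfV ?powRr1 ?addr_ge0 //.
    by rewrite kR pnatr_eq0 -lt0n.
  apply: ge0_ler_powR; rewrite ?nnegrE ?exprn_ge0 ?addr_ge0 ?(ltW d0) //.
  (* Superadditivity of the power k - 2 turns the error added to [m ^+ (k - 2)] into one added to
     [m]. *)
  rewrite (le_trans hu) // (le_trans _ (exprD_ge _ _ _)) // lerD2l.
  by rewrite /slice_error kR powR_root // divr_ge0 // ltW.
have s0 : 0 <= slice_error R n k by rewrite powR_ge0.
by lra.
Qed.
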